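(* For all integers $n,m\geq 3$, $s_5(P_n\square P_m)=4$.
   Context: $P_k$ denotes the path on $k$ vertices, and $\square$ denotes the Cartesian product of graphs. A $P_k$-coloring of a graph $G$ is a proper vertex coloring of $G$ in which no copy of $P_k$ in $G$ (as a subgraph, not necessarily induced) is bicolored, i.e. has its vertices colored using only two colors. The $P_k$-chromatic number $s_k(G)$ is the minimum number of colors in a $P_k$-coloring of $G$. *)

(* Defs.v *)
From mathcomp Require Import all_boot.

Set Implicit Arguments.
Unset Strict Implicit.
Unset Printing Implicit Defensive.

Record sgraph := SGraph {
  vertex :> finType;
  edge : rel vertex;
  edge_sym : symmetric edge;
  edge_irr : irreflexive edge }.

Section PathGraph.
Variable n : nat.

Definition path_edge : rel 'I_n := fun i j => (i.+1 == j) || (j.+1 == i).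

Lemma path_edge_sym : symmetric path_edge.
Proof. by move=> i j; rewrite /path_edge orbC. Qed.

Lemma path_edge_irr : irreflexive path_edge.
Proof. by move=> i; rewrite /path_edge orbb gtn_eqF. Qed.

Definition path_graph : sgraph := SGraph path_edge_sym path_edge_irr.
End PathGraph.

Section CartesianProduct.
Variables G H : sgraph.

Definition box_edge : rel (G * H) := fun x y =>
  ((x.1 == y.1) && edge x.2 y.2) || ((x.2 == y.2) && edge x.1 y.1).

Lemma box_edge_sym : symmetric box_edge.
Proof.
move=> x y; rewrite /box_edge (eq_sym x.1) (eq_sym x.2).
by rewrite (edge_sym x.1) (edge_sym x.2).
Qed.

Lemma box_edge_irr : irreflexive box_edge.
Proof. by move=> x; rewrite /box_edge !edge_irr !andbF. Qed.

Definition box : sgraph := SGraph box_edge_sym box_edge_irr.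
End CartesianProduct.

(* f embeds H as a subgraph of G, not necessarily an induced one. *)
Definition is_copy (H G : sgraph) (f : {ffun H -> G}) : bool :=
  injectiveb f && [forall x, forall y, edge x y ==> edge (f x) (f y)].

Section Coloring.
Variables (k : nat) (G : sgraph).

Definition proper_coloring (q : nat) (c : {ffun G -> 'I_q}) : bool :=
  [forall x, forall y, edge x y ==> (c x != c y)].

Definition bicolored (q : nat) (c : {ffun G -> 'I_q})
    (f : {ffun path_graph k -> G}) : bool :=
  #|[set c (f i) | i : path_graph k]| <= 2.

Definition Pk_coloring (q : nat) (c : {ffun G -> 'I_q}) : bool :=
  proper_coloring c &&
  [forall f : {ffun path_graph k -> G}, is_copy f ==> ~~ bicolored c f].

Definition Pk_colorable (q : nat) : bool :=
  [exists c : {ffun G -> 'I_q}, Pk_coloring c].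

(* For k >= 3 an injective coloring is a P_k-coloring, so it is enough to
   minimize over q <= #|G|; see Pk_chromatic_numberP. For k <= 2 the value is
   not meaningful, as there may be no P_k-coloring at all. *)
Definition Pk_chromatic_number : nat :=
  [arg min_(q < (ord_max : 'I_#|G|.+1) | Pk_colorable q) q].

Lemma Pk_colorable_card : 2 < k -> Pk_colorable #|G|.
Proof.
move=> k_gt2; apply/existsP; exists [ffun x => enum_rank x].
apply/andP; split.
  apply/forallP=> x; apply/forallP=> y; apply/implyP=> xy; rewrite !ffunE.
  by rewrite (inj_eq enum_rank_inj); apply: contraTneq xy => ->; rewrite edge_irr.
apply/forallP=> f; apply/implyP=> /andP[/injectiveP f_inj _].
rewrite /bicolored -ltnNge card_imset ?card_ord // => i j.
by rewrite !ffunE => /enum_rank_inj /f_inj.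
Qed.

Lemma Pk_chromatic_numberP : 2 < k ->
  Pk_colorable Pk_chromatic_number /\
  (forall q, Pk_colorable q -> Pk_chromatic_number <= q).
Proof.
move=> k_gt2; rewrite /Pk_chromatic_number.
case: arg_minnP => [|q col_q q_min]; first exact: Pk_colorable_card.
split=> // r col_r; case: (ltnP r #|G|.+1) => [r_lt|/ltnW r_ge].
  exact: (q_min (Ordinal r_lt) col_r).
by apply: leq_trans r_ge; rewrite -ltnS.
Qed.
End Coloring.

(* Main.v *)
Require Import Defs.
From mathcomp Require Import all_boot.
From mathcomp Require Import zify.

(** A proper coloring of a P_5 uses two colors only if the colors alternate.

    Upper bound: color (i, j) by the 8-periodic word 0 1 2 0 3 1 2 3 read at
    i + 2j.  Vertices at distance 1 or 2 get distinct residues mod 8, so a P_5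
    becomes a non-backtracking walk on Z/8 with steps +-1, +-2, and no such walk
    has alternating colors.

    Lower bound: an exhaustive search over the 3-colorings of the 3 x 3 corner,
    whose vertex (i, j) is numbered 3i + j. *)

(** * Bicolored paths on five vertices as alternating ones *)

Lemma card_le2_eq {T : finType} {A : {set T}} {x y z} :
  #|A| <= 2 -> x \in A -> y \in A -> z \in A -> x != y -> y != z -> x = z.
Proof.
move=> A2 Ax Ay Az xy yz; apply/eqP; apply: contraTT A2 => xz.
rewrite -ltnNge; have -> : 3 = size [:: x; y; z] by [].
rewrite -(card_uniqP _); last by rewrite /= !inE negb_or xy xz yz.
by apply/subset_leq_card/subsetP => t; rewrite !inE => /or3P[]/eqP->.
Qed.

(** Consecutive colors differ, so with only two colors available vertices two apart agree;
    conversely the three equalities leave only the colors of [x0] and [x1]. Embeddings are traded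
    for explicit vertex sequences, which both bounds use. *)
Lemma P5_coloringP {G : sgraph} {q} {c : {ffun G -> 'I_q}} :
  reflect ((forall x y, edge x y -> c x != c y) /\
           (forall x0 x1 x2 x3 x4,
              uniq [:: x0; x1; x2; x3; x4] ->
              path (@edge G) x0 [:: x1; x2; x3; x4] ->
              ~ [/\ c x0 = c x2, c x2 = c x4 & c x1 = c x3]))
          (Pk_coloring 5 c).
Proof.
have properP : reflect (forall x y, edge x y -> c x != c y) (proper_coloring c).
  apply: (iffP forallP) => [H x y xy | H x].
    by have /forallP/(_ y)/implyP/(_ xy) := H x.
  by apply/forallP => y; apply/implyP; apply: H.
apply: (iffP andP) => [[/properP cE /forallP cP] | [cE cP]]; split=> //.
- move=> x0 x1 x2 x3 x4 xU xP [c02 c24 c13].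
  pose s := [:: x0; x1; x2; x3; x4].
  pose f := [ffun i : path_graph 5 => nth x0 s i].
  have : is_copy f.
    apply/andP; split.
      apply/injectiveP => i j; rewrite !ffunE => /eqP.
      by rewrite nth_uniq // => /eqP/val_inj.
    apply/forallP => i; apply/forallP => j; apply/implyP; rewrite !ffunE.
    have step k : k < 4 -> edge (nth x0 s k) (nth x0 s k.+1).
      by move=> k4; apply: (pathP x0 xP).
    case/orP => /eqP ij.
      by rewrite -ij; apply: step; rewrite -ltnS ij ltn_ord.
    by rewrite edge_sym -ij; apply: step; rewrite -ltnS ij ltn_ord.
  move/implyP: (cP f) => /[apply] /negP; apply.
  apply: (@leq_trans #|[set c x0; c x1]|); last by rewrite cards2; case: eqP.
  apply/subset_leq_card/subsetP => t /imsetP[[i lti] _ ->].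
  rewrite ffunE !inE; case: i lti => [|[|[|[|[|//]]]]] _ /=.
  + by rewrite eqxx.
  + by rewrite eqxx orbT.
  + by rewrite c02 eqxx.
  + by rewrite c13 eqxx orbT.
  + by rewrite c02 c24 eqxx.
- exact/properP.
- apply/forallP => f; apply/implyP => /andP[/injectiveP fI /forallP fE].
  rewrite /bicolored; apply/negP => f2.
  pose o k (lt : k < 5) : path_graph 5 := Ordinal lt.
  pose i0 := @o 0 isT; pose i1 := @o 1 isT; pose i2 := @o 2 isT.
  pose i3 := @o 3 isT; pose i4 := @o 4 isT.
  have E i j : edge i j -> edge (f i) (f j).
    by have /forallP/(_ j)/implyP := fE i.
  have A i : c (f i) \in [set c (f i) | i : path_graph 5] by apply: imset_f.
  have alt i j k : edge i j -> edge j k -> c (f i) = c (f k).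
    move=> ij jk; apply: (card_le2_eq f2 (A i) (A j) (A k)).
      exact/cE/E.
    exact/cE/E.
  apply: (cP (f i0) (f i1) (f i2) (f i3) (f i4)).
  + by rewrite (map_inj_uniq fI [:: i0; i1; i2; i3; i4]).
  + by rewrite /= !E.
  + by split; [apply: (alt _ i1) | apply: (alt _ i3) | apply: (alt _ i2)].
Qed.

(** * Upper bound: the periodic coloring *)

Definition word8 (r : nat) : nat := nth 0 [:: 0; 1; 2; 0; 3; 1; 2; 3] r.

(** The offsets 6 and 7 stand for -2 and -1 modulo 8. *)
Definition step8 (r s : nat) : bool := s \in [seq (r + d) %% 8 | d <- [:: 1; 2; 6; 7]].

Lemma word8_proper r s : r < 8 -> step8 r s -> word8 r != word8 s.
Proof.
have H : all (fun r => all (fun d => word8 r != word8 ((r + d) %% 8))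
  [:: 1; 2; 6; 7]) (iota 0 8) by [].
move=> r8 /mapP[d dS ->]; have rS : r \in iota 0 8 by rewrite mem_iota.
exact: (allP (allP H _ rS) _ dS).
Qed.

(** Finite check over 8 starting points and four choices at each of four steps. The disequalities
    exclude backtracking, as a walk going to and fro on one edge alternates. *)
Lemma word8_no_alternating_walk r0 r1 r2 r3 r4 :
  r0 < 8 -> path step8 r0 [:: r1; r2; r3; r4] ->
  r0 != r2 -> r1 != r3 -> r2 != r4 ->
  ~ [/\ word8 r0 = word8 r2, word8 r2 = word8 r4 & word8 r1 = word8 r3].
Proof.
pose nxt r := [seq (r + d) %% 8 | d <- [:: 1; 2; 6; 7]].
have H : all (fun r0 => all (fun r1 => all (fun r2 => all (fun r3 =>
    all (fun r4 => [|| r0 == r2, r1 == r3, r2 == r4 |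
      ~~ [&& word8 r0 == word8 r2, word8 r2 == word8 r4 & word8 r1 == word8 r3]])
    (nxt r3)) (nxt r2)) (nxt r1)) (nxt r0)) (iota 0 8) by vm_compute.
move=> r8 /and5P[s1 s2 s3 s4 _] /negPf n02 /negPf n13 /negPf n24 [e02 e24 e13].
have r0S : r0 \in iota 0 8 by rewrite mem_iota.
by move: (allP (allP (allP (allP (allP H _ r0S) _ s1) _ s2) _ s3) _ s4);
  rewrite n02 n13 n24 e02 e24 e13 !eqxx.
Qed.

Section Box.
Context {n m : nat}.
Local Notation G := (box (path_graph n) (path_graph m)).

Definition residue (x : G) : nat := (x.1 + 2 * x.2) %% 8.

Lemma box_edgeP {x y : G} : edge x y ->
  [\/ x.1 = y.1 :> nat /\ x.2.+1 = y.2 :> nat,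
      x.1 = y.1 :> nat /\ y.2.+1 = x.2 :> nat,
      x.2 = y.2 :> nat /\ x.1.+1 = y.1 :> nat |
      x.2 = y.2 :> nat /\ y.1.+1 = x.1 :> nat].
Proof.
case/orP => /andP[/eqP -> /orP[]/eqP ->];
  by [constructor 1 | constructor 2 | constructor 3 | constructor 4].
Qed.

Lemma residue_step {x y : G} : edge x y -> step8 (residue x) (residue y).
Proof.
rewrite /step8 /residue !inE.
by case/box_edgeP => -[]; lia.
Qed.

(** Two steps that do not cancel change [x.1 + 2 * x.2] by 1, 2, 3 or 4 up to sign, never by a
    multiple of 8. *)
Lemma residue_dist2 {x y z : G} :
  edge x y -> edge y z -> x != z -> residue x != residue z.
Proof.
move=> /box_edgeP xy /box_edgeP yz; apply: contraNneq => rxz.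
apply/eqP; case: x y z xy yz rxz => [x1 x2] [y1 y2] [z1 z2].
rewrite /residue /= => xy yz rxz.
have [] : x1 = z1 :> nat /\ x2 = z2 :> nat.
  by case: xy yz => -[? ?] [] [? ?]; lia.
by move=> /val_inj -> /val_inj ->.
Qed.

Lemma box_P5_colorable4 : Pk_colorable 5 G 4.
Proof.
have lt4 r : word8 r < 4.
  by rewrite /word8; do 8?case: r => [//|r]; rewrite nth_default.
have lt8 x : residue x < 8 by rewrite ltn_pmod.
apply/existsP; exists [ffun x => Ordinal (lt4 (residue x))].
apply/P5_coloringP; split=> [x y xy | x0 x1 x2 x3 x4 xU].
  by rewrite !ffunE -val_eqE /= word8_proper // residue_step.
rewrite !ffunE => /and5P[e01 e12 e23 e34 _]
  [/(congr1 val) /= c02 /(congr1 val) /= c24 /(congr1 val) /= c13].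
(* Of the ten disequalities, those between vertices two apart are kept. *)
move: xU; rewrite /= !inE !negb_or -!andbA.
case/and5P=> _ n02 _ _ /and5P[_ n13 _ _ /andP[n24 _]].
apply: (@word8_no_alternating_walk (residue x0) (residue x1) (residue x2)
  (residue x3) (residue x4)) => //.
- by rewrite /= !residue_step.
- exact: (residue_dist2 e01 e12 n02).
- exact: (residue_dist2 e12 e23 n13).
- exact: (residue_dist2 e23 e34 n24).
Qed.

End Box.

(** * Lower bound: search on the 3 x 3 corner *)

Definition adj33 (j k : nat) : bool :=
  ((j %/ 3 == k %/ 3) && ((j %% 3).+1 == k %% 3)) ||
  ((j %/ 3 == k %/ 3) && ((k %% 3).+1 == j %% 3)) ||
  ((j %% 3 == k %% 3) && ((j %/ 3).+1 == k %/ 3)) ||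
  ((j %% 3 == k %% 3) && ((k %/ 3).+1 == j %/ 3)).

Definition prepend33 (ps : seq (seq nat)) : seq (seq nat) :=
  flatten [seq [seq y :: p | y <- iota 0 9 & adj33 y (head 0 p) && (y \notin p)]
          | p <- ps].

(** [k] counts edges: lengths 1 and 4 give the edges and the copies of [P_5]. *)
Definition walks33 (k : nat) : seq (seq nat) :=
  iter k prepend33 [seq [:: x] | x <- iota 0 9].

(** A constraint is tested only once all its vertices are colored by the prefix [s]; two vertices
    test properness, five test alternation. *)
Definition violated (s : seq nat) (p : seq nat) : bool :=
  if all (fun x => x < size s) p then
    match [seq nth 0 s x | x <- p] with
    | [:: a; b] => a == b
    | [:: a; b; c; d; e] => [&& a == c, c == e & b == d]
    | _ => false
    end
  else false.

Definition constraints33 : seq (seq nat) := walks33 1 ++ walks33 4.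

(* [s] lists the colors of the first vertices, [k] counts the remaining ones.
   The test is an [if] because [||] would be evaluated strictly by [vm_compute],
   which would disable the pruning. *)
Fixpoint refuted (ps : seq (seq nat)) (k : nat) (s : seq nat) : bool :=
  if has (violated s) ps then true else
  if k is k'.+1 then all (fun a => refuted ps k' (rcons s a)) (iota 0 3)
  else false.

(** Follow the branch of the search tree that colors according to [f]: it must be cut at some
    prefix. *)
Lemma refutedP ps (f : nat -> nat) k j : (forall i, f i < 3) ->
  refuted ps k (mkseq f j) -> exists2 i, i <= j + k & has (violated (mkseq f i)) ps.
Proof.
move=> f3; elim: k j => [|k IH] j; rewrite [refuted _ _ _]/=;
  case: (boolP (has _ ps)) => [bad _ | _] //; try by exists j; rewrite ?leq_addr.
have fj : f j \in iota 0 3 by rewrite mem_iota f3.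
move=> H.
have := allP (H : all (fun a => refuted ps k (rcons (mkseq f j) a)) (iota 0 3)) _ fj.
by rewrite -mkseqS => /IH; rewrite addSnnS.
Qed.

Lemma grid33_refuted : refuted constraints33 9 [::].
Proof. by vm_compute. Qed.

(** Soundness of the enumeration: each list is a genuine path of the grid. *)
Lemma constraints33P {p} : p \in constraints33 ->
  [/\ uniq p, all (fun x => x < 9) p & sorted adj33 p].
Proof.
have /allP H : all (fun p => [&& uniq p, all (fun x => x < 9) p & sorted adj33 p])
  constraints33 by vm_compute.
by move=> /H /and3P[].
Qed.

Lemma box_P5_colorable_ge4 {n m q} : 3 <= n -> 3 <= m ->
  Pk_colorable 5 (box (path_graph n) (path_graph m)) q -> 4 <= q.
Proof.
move=> hn hm /existsP[c /P5_coloringP[cE cP]]; rewrite leqNgt; apply/negP => q3.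
have lt3 k l : 3 <= l -> k %% 3 < l by apply: leq_trans; rewrite ltn_pmod.
(* [lt3] also reduces the row modulo 3, which makes [v] total and changes nothing for [k < 9]. *)
pose v k : box (path_graph n) (path_graph m) :=
  (Ordinal (lt3 (k %/ 3) n hn), Ordinal (lt3 k m hm)).
have v_inj : {in [pred k | k < 9] &, injective v}.
  move=> j k; rewrite !inE => j9 k9 []; lia.
have v_edge j k : j < 9 -> k < 9 -> adj33 j k -> edge (v j) (v k).
  move=> j9 k9; rewrite /adj33 /= /box_edge /= /path_edge /= -!val_eqE /=.
  have d3 i : i < 9 -> i %/ 3 %% 3 = i %/ 3 by move=> ?; lia.
  rewrite !d3 //.
  by do 4?[case: eqP => ?]; rewrite ?orbT ?andbT ?orbF.
pose f k : nat := c (v k).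
(* Since [q <= 3], colorings with fewer than three colors are covered too. *)
have f3 k : f k < 3 by apply: leq_trans (ltn_ord _) _.
have [i _ /hasP[p /constraints33P[pU p9 pS] pV]] :=
  refutedP constraints33 f 9 0 f3 grid33_refuted.
move: pV; rewrite /violated; case: ifP => // p_lt.
have -> : [seq nth 0 (mkseq f i) x | x <- p] = [seq f x | x <- p].
  apply/eq_in_map => x xp; rewrite nth_mkseq //.
  by have := allP p_lt x xp; rewrite size_mkseq.
have vU : uniq (map v p).
  by rewrite map_inj_in_uniq // => x y xp yp; apply: v_inj; apply: (allP p9).
have vS : sorted (@edge _) (map v p).
  case: p p9 pS {pU p_lt vU} => //= x p /andP[x9 p9].
  elim: p x x9 p9 => //= y p IH x x9 /andP[y9 p9] /andP[xy yp].
  by apply/andP; split; [apply: v_edge | apply: IH].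
(* Only lengths 2 and 5 survive, contradicting [cE] and [cP] respectively. *)
case: p vU vS {p_lt pU p9 pS} => [|x0 [|x1 [|x2 [|x3 [|x4 [|//]]]]]] //= vU vS.
  by move/eqP/val_inj/eqP; apply/negP/cE; case/andP: vS.
move=> /and3P[/eqP/val_inj c02 /eqP/val_inj c24 /eqP/val_inj c13].
exact: (cP (v x0) (v x1) (v x2) (v x3) (v x4)).
Qed.

Theorem theorem8 (n m : nat) (hn : 3 <= n) (hm : 3 <= m) :
  Pk_chromatic_number 5 (box (path_graph n) (path_graph m)) = 4.
Proof.
have [col4 min4] := @Pk_chromatic_numberP 5 (box (path_graph n) (path_graph m)) isT.
apply/eqP; rewrite eqn_leq min4 ?box_P5_colorable4 //=.
exact: box_P5_colorable_ge4 hn hm col4.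
Qed.
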